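(* Let $G$ be a countable amenable group and let $X$ be a $G$-subshift of finite type admitting a fully supported shift-invariant Borel probability measure. If $X$ has bounded chain exchangeability (BCE), then $(X,\sigma)$ has topological completely positive entropy (topological CPE).
   Context: For a finite alphabet $\mathcal A$, a $G$-subshift is a subset $X\subset\mathcal A^{G}$ closed in the product topology and invariant under the shift action $\sigma^g(x)_h=x_{g^{-1}h}$; it is of finite type (SFT) if it is the set of all configurations in which no pattern from some fixed finite set of forbidden finite patterns appears. A $G$-topological dynamical system $(X,T)$ is a compact metric space with a left $G$-action by homeomorphisms. A factor of $(X,T)$ is a $G$-topological dynamical system $(Y,S)$ for which there is a continuous surjective $G$-equivariant map $X\to Y$; it is non-trivial if $Y$ has more than one point. $(X,T)$ has topological CPE if every non-trivial factor has positive topological entropy, where topological entropy is $\sup_{\mathcal U}\lim_n\frac{1}{|F_n|}\log N(\bigvee_{g\in F_n}T^{g^{-1}}\mathcal U)$ over open covers $\mathcal U$, with $\{F_n\}$ a (left) Følner sequence (finite sets with $|KF_n\triangle F_n|/|F_n|\to0$ for every finite $K\subset G$) and $N$ the minimum cardinality of a subcover. For finite $F\subset G$, $L_F(X)=\{x|_F: x\in X\}$. A pair $(x,y)\in X^2$ is asymptotic if $x$ and $y$ agree outside a finite subset of $G$. Patterns $p,q\in L_F(X)$ are exchangeable if there is an asymptotic pair $(x,y)\in X^2$ with $x|_F=p$ and $y|_F=q$. They are $n$-chain exchangeable if there are patterns $r_0,\dots,r_n\in\mathcal A^F$ with $p=r_0$, $q=r_n$ and $r_{i-1},r_i$ exchangeable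 for every $i\in\{1,\dots,n\}$. $X$ has BCE if there is $N\in\mathbb{N}$ such that for every finite $F\subset G$ every pair $p,q\in L_F(X)$ is $N$-chain exchangeable. *)

(* Defs.v *)
From HB Require Import structures.
From mathcomp Require Import all_boot all_order all_algebra.
From mathcomp Require Import finmap.
From mathcomp Require Import all_classical all_reals all_analysis.
Set Implicit Arguments.
Unset Strict Implicit.
Unset Printing Implicit Defensive.
Import Order.TTheory GRing.Theory Num.Theory.
Import numFieldTopology.Exports.
Local Open Scope classical_set_scope.
Local Open Scope card_scope.
Local Open Scope ring_scope.

(* Finite alphabets; [Pointed] only says that the alphabet is nonempty, which
   the library requires of any type carrying a sigma-algebra. *)
#[short(type="alphabetType")]
HB.structure Definition Alphabet := {A of Finite A & Pointed A}.

Section Amenability.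
Variables (R : realType) (G : groupType).

Definition fset_mul (K F : {fset G}) : {fset G} :=
  [fset (k * f)%g | k in K, f in F]%fset.

Definition fset_symdiff (K F : {fset G}) : {fset G} :=
  ((K `\` F) `|` (F `\` K))%fset.

(* [K] must be nonempty: for [K] empty the ratio below is constantly 1. *)
Definition is_folner (F : nat -> {fset G}) : Prop :=
  (forall n, F n != fset0) /\
  forall K : {fset G}, K != fset0 ->
    (#|` fset_symdiff (fset_mul K (F n)) (F n)|%:R / #|` F n|%:R : R) @[n --> \oo]
      --> (0 : R).

(* The usual characterization of amenability among countable groups. *)
Definition amenable : Prop := exists F, is_folner F.

End Amenability.

Section Dynamics.
Variables (R : realType) (G : groupType).

Definition is_continuous_action (Y : topologicalType) (S : G -> Y -> Y) : Prop :=
  [/\ forall y, S 1%g y = y,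
      forall g h y, S (g * h)%g y = S g (S h y)
    & forall g, continuous (S g)].

Definition open_cover (Y : topologicalType) (U : set (set Y)) : Prop :=
  (forall A, U A -> open A) /\ \bigcup_(A in U) A = [set: Y].

Definition subcover_card (Y : Type) (V : set (set Y)) (n : nat) : Prop :=
  exists W : set (set Y),
    [/\ W `<=` V, W #= `I_n & \bigcup_(A in W) A = [set: Y]].

(* The minimum cardinality of a subcover of [V] (0 if no finite subcover). *)
Definition min_subcover (Y : Type) (V : set (set Y)) : nat :=
  get [set n | subcover_card V n /\ forall m, subcover_card V m -> (n <= m)%N].

Definition join_cover (Y : Type) (S : G -> Y -> Y) (F : {fset G})
    (U : set (set Y)) : set (set Y) :=
  [set \bigcap_(g in [set` F]) (S g^-1%g @` W g) |
     W in [set W : G -> set Y | forall g, g \in F -> U (W g)]].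

(* The limit exists along every Folner sequence (Ornstein-Weiss lemma). *)
Definition cover_entropy (F : nat -> {fset G}) (Y : Type) (S : G -> Y -> Y)
    (U : set (set Y)) : R :=
  limn (fun n => (#|` F n|%:R)^-1 * ln (min_subcover (join_cover S (F n) U))%:R).

Definition topological_entropy (F : nat -> {fset G}) (Y : topologicalType)
    (S : G -> Y -> Y) : \bar R :=
  ereal_sup [set (cover_entropy F S U)%:E | U in @open_cover Y].

(* [(Y, S)] is a factor of the action [T] restricted to the invariant set [X]. *)
Definition is_factor (Z : topologicalType) (X : set Z) (T : G -> Z -> Z)
    (Y : topologicalType) (S : G -> Y -> Y) : Prop :=
  exists phi : Z -> Y,
    [/\ {within X, continuous phi}, phi @` X = [set: Y]
      & forall g x, X x -> phi (T g x) = S g (phi x)].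

(* The entropy does not depend on the Folner sequence; it is required to be
   positive when computed along each of them. *)
Definition topological_CPE (Z : topologicalType) (X : set Z) (T : G -> Z -> Z) :
    Prop :=
  forall (Y : metricType R) (S : G -> Y -> Y),
    compact [set: Y] -> is_continuous_action S -> is_factor X T S ->
    (exists y y' : Y, y <> y') ->
    forall F, is_folner R F -> (0 < topological_entropy F S)%E.

End Dynamics.

Section Subshifts.
Variables (R : realType) (G : groupType) (A : alphabetType).

Definition fullshift := prod_topology (fun _ : G => discrete_topology A).

Definition shift_act (g : G) (x : fullshift) : fullshift :=
  fun h => x (g^-1 * h)%g.

Definition is_subshift (X : set fullshift) : Prop :=
  closed X /\ forall g x, X x -> X (shift_act g x).

Definition restr (F : {fset G}) (x : fullshift) : {ffun F -> A} :=
  [ffun h : F => x (val h)].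

Definition pattern := {F : {fset G} & {ffun F -> A}}.

Definition appears (p : pattern) (x : fullshift) : Prop :=
  exists g, restr (tag p) (shift_act g x) = tagged p.

Definition is_SFT (X : set fullshift) : Prop :=
  exists2 P : set pattern, finite_set P &
    X = [set x | forall p, P p -> ~ appears p x].

Definition asymptotic (x y : fullshift) : Prop :=
  exists F : {fset G}, forall h, h \notin F -> x h = y h.

Definition language (X : set fullshift) (F : {fset G}) : set {ffun F -> A} :=
  restr F @` X.
Arguments language : clear implicits.

Definition exchangeable (X : set fullshift) (F : {fset G})
    (p q : {ffun F -> A}) : Prop :=
  exists x y, [/\ X x, X y, asymptotic x y, restr F x = p & restr F y = q].

Definition chain_exchangeable (X : set fullshift) (n : nat) (F : {fset G})
    (p q : {ffun F -> A}) : Prop :=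
  exists r : nat -> {ffun F -> A},
    [/\ r 0%N = p, r n = q
      & forall i, (i < n)%N -> exchangeable X (r i) (r i.+1)].

Definition BCE (X : set fullshift) : Prop :=
  exists N : nat, forall (F : {fset G}) (p q : {ffun F -> A}),
    language X F p -> language X F q -> chain_exchangeable X N p q.

Definition borel := g_sigma_algebraType (@open fullshift).

Definition shift_invariant (mu : set borel -> \bar R) : Prop :=
  forall g (B : set borel), measurable B -> mu (shift_act g @^-1` B) = mu B.

Definition msupport (mu : set borel -> \bar R) : set fullshift :=
  [set x | forall U : set fullshift, open U -> U x -> (0 < mu U)%E].

(* A Borel probability measure on [X] is given as one on the full shift_act
   that is carried by [X]. *)
Definition has_full_invariant_measure (X : set fullshift) : Prop :=
  exists mu : probability borel R,
    [/\ mu X = 1%E, shift_invariant mu & msupport mu = X].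

End Subshifts.

(* Main.v *)
Require Import Defs.
From mathcomp Require Import all_boot all_order all_algebra.
From mathcomp Require Import finmap.
From mathcomp Require Import all_classical all_reals all_analysis.
From mathcomp Require Import measurable_realfun.
From mathcomp Require Import zify ring lra.
Set Implicit Arguments.
Unset Strict Implicit.
Unset Printing Implicit Defensive.
Import Order.TTheory GRing.Theory Num.Theory.
Import numFieldNormedType.Exports.
Local Open Scope ring_scope.
Local Open Scope classical_set_scope.
Local Open Scope card_scope.

(** Let [phi] be a factor map from [X] onto a space [Y] with two points.

    Some asymptotic pair of [X] is separated by [phi]. Otherwise, follow a chain
    of [N] exchanges between the patterns on [D] of two given points: each
    exchange is realised by an asymptotic pair, along which [phi] is constant,
    and between two exchanges one passes from a point of [X] to another one with
    the same pattern on [D], which moves [phi] very little when [D] is large. As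
    [N] does not depend on [D], the map [phi] would be constant
    ([BCE_separates_asymptotic_pair]).

    Let [x] and [y] be points of [X] that agree outside [K], with
    [phi x <> phi y]. As [X] is of finite type, an occurrence of the pattern of
    [x] on a large set [E] around [K] in a point of [X] can be replaced by the
    pattern of [y], and this can be done independently at any set of disjoint
    occurrences ([implant_mem]). The pattern of [x] on [E] has positive measure,
    so by invariance and averaging some point of [X] has at least [alpha * #|F|]
    occurrences of it located in [F] ([frequent_occurrences]), and a fixed
    proportion of them are disjoint ([exists_disjoint_translates]). The points
    of [Y] obtained by choosing between [x] and [y] at each of these places are
    told apart by the open cover made of the complements of two disjoint closed
    balls around [phi x] and [phi y]. Hence the cover number of this cover over
    [F] grows exponentially in [#|F|] ([asymptotic_pair_cover_growth]).

    As the entropy of a cover is a limit, this exponential growth makes it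
    positive only once the limit is known to exist. This is the Ornstein-Weiss
    lemma, proved here for subadditive right-invariant functions of finite sets
    along Gromov's lines: a very invariant set is filled, up to a small
    proportion, by almost disjoint translates of sets where the function is
    small, whose contribution is thus small ([greedy_filling],
    [bounded_on_invariant_step], [ornstein_weiss]). *)

(** * Boundaries and fillings of finite subsets of a group *)

Section Boundaries.
Variable G : groupType.
Local Open Scope fset_scope.
Implicit Types (k c : G) (A B D E : {fset G}).

Definition rtranslate D c : {fset G} := [fset (d * c)%g | d in D]%fset.

Definition boundary k E : nat := #|` [fset x in E | (k * x)%g \notin E]|%fset.

Lemma card_sep_sum (T : choiceType) (E : {fset T}) (P : pred T) :
  #|` [fset x in E | P x]|%fset = (\sum_(x <- E) P x)%N.
Proof. by rewrite card_fset_sum1 -big_fset_condE /= big_mkcond. Qed.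

Lemma mem_rtranslate D c x : (x \in rtranslate D c) = ((x * c^-1)%g \in D).
Proof.
apply/imfsetP/idP => [[d dD ->]|xD]; first by rewrite mulgK.
by exists (x * c^-1)%g => //; rewrite mulgVK.
Qed.

Lemma card_rtranslate D c : #|` rtranslate D c| = #|` D|.
Proof. by rewrite card_imfset //; exact: mulIg. Qed.

Lemma card_ltranslate k E : #|` [fset (k * x)%g | x in E]| = #|` E|.
Proof. by rewrite card_imfset //; exact: mulgI. Qed.

Lemma boundary_rtranslate k D c : boundary k (rtranslate D c) = boundary k D.
Proof.
rewrite /boundary -[RHS](card_rtranslate _ c); congr (#|` _|).
apply/fsetP => x; rewrite mem_rtranslate !inE !mem_rtranslate.
by rewrite mulgA.
Qed.

Lemma boundaryU k A B : (boundary k (A `|` B) <= boundary k A + boundary k B)%N.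
Proof.
apply: leq_trans (leq_card_fsetU _ _); apply: fsubset_leq_card.
apply/fsubsetP => x; rewrite !inE negb_or.
by case/andP => /orP[] -> /andP[-> ->]; rewrite ?orbT.
Qed.

(** Leaving [E `\` A] means leaving [E] or entering [A]; as left translation
    preserves cardinals, as many points enter [A] as leave it. *)
Lemma boundaryD k A E : (boundary k (E `\` A) <= boundary k E + boundary k A)%N.
Proof.
pose inn := [fset x in E `\` A | (k * x)%g \in A]%fset.
have innA : (#|` inn| <= boundary k A)%N.
  have : (#|` A| <= #|` [fset (k * x)%g | x in A]|)%N by rewrite card_ltranslate.
  have sub : ([fset (k * x)%g | x in inn] `<=` A `\` [fset (k * x)%g | x in A])%fset.
    apply/fsubsetP => _ /imfsetP[x /= + ->]; rewrite !inE => /andP[/andP[xA xE] ->].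
    by rewrite andbT; apply: contra xA => /imfsetP[y /= yA /mulgI ->].
  have := fsubset_leq_card sub; rewrite card_ltranslate.
  have -> : boundary k A = #|` [fset (k * x)%g | x in A] `\` A|%fset.
    rewrite -[LHS](card_ltranslate k); congr (#|` _|); apply/fsetP => y.
    apply/imfsetP/idP => [[x /= + ->]|].
      by rewrite !inE => /andP[xA ->]; apply/imfsetP; exists x.
    rewrite !inE => /andP[yA /imfsetP[x /= xA yE]]; exists x => //=.
    by rewrite !inE xA /= -yE.
  rewrite !cardfsD card_ltranslate.
  by rewrite [in X in (_ <= X -> _)%N]fsetIC.
apply: leq_trans (leq_add (leqnn _) innA); apply: leq_trans (leq_card_fsetU _ _).
apply: fsubset_leq_card; apply/fsubsetP => x; rewrite !inE.
case: (x \in A) => //=; case: (x \in E) => //=; case: (_ \in E) => //=.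
by rewrite andbT negbK.
Qed.

End Boundaries.

Section Filling.
Variables (R : realType) (G : groupType) (h : {fset G} -> R).
Hypothesis h0 : h fset0 <= 0.
Hypothesis hU : forall A B, h (A `|` B)%fset <= h A + h B.
Hypothesis hT : forall A c, h (rtranslate A c) <= h A.
Implicit Types (A B C D E K : {fset G}).

(** An element [c] of [E] with [rtranslate D c] not inside [E] is counted in
    [boundary d E] for some [d] in [D]. *)
Lemma leq_centers D E :
  (#|` E| <= #|` [fset c in E | (rtranslate D c `<=` E)%fset]|%fset
             + \sum_(d <- D) boundary d E)%N.
Proof.
rewrite /boundary card_fset_sum1 !card_sep_sum.
under [X in (_ + X)%N]eq_bigr do rewrite card_sep_sum.
rewrite exchange_big -big_split /= !big_seq leq_sum // => c cE.
case: (boolP (_ `<=` _)%fset) => // /fsubsetPn[_ /imfsetP[d /= dD ->] dcE].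
by rewrite (big_fsetD1 d dD) /= dcE addnA addn1.
Qed.

Lemma leq_sum_overlap A C D :
  (\sum_(c <- C) #|` rtranslate D c `&` A|%fset <= #|` D| * #|` A|)%N.
Proof.
have E c : #|` rtranslate D c `&` A|%fset = (\sum_(d <- D) ((d * c)%g \in A))%N.
  rewrite -card_sep_sum -[RHS](card_rtranslate _ c); congr (#|` _|).
  by apply/fsetP => x; rewrite !inE !mem_rtranslate !inE mulgVK.
under eq_bigr do rewrite E.
rewrite exchange_big /= -sum1_size big_distrl /=.
apply: leq_sum => d _; rewrite mul1n -card_sep_sum.
rewrite -(card_ltranslate d); apply: fsubset_leq_card.
by apply/fsubsetP => _ /imfsetP[c /= + ->]; rewrite !inE => /andP[].
Qed.

(** [A] is the union of a maximal family of [m] translates of [D] inside [E],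
    each new one meeting the previous ones in less than [eps * #|D|] points. By
    maximality every translate inside [E] meets [A] in at least [eps * #|D|]
    points, while a point of [A] lies in at most [#|D|] translates: this double
    counting gives the last inequality. *)
Lemma greedy_filling (eps : R) D E : 0 < eps < 1 -> D != fset0 ->
  exists A (m : nat),
    [/\ (A `<=` E)%fset, (1 - eps) * (m%:R * #|` D|%:R) <= #|` A|%:R,
        h A <= m%:R * h D, forall k, (boundary k A <= m * boundary k D)%N
      & eps * (#|` E|%:R - (\sum_(d <- D) boundary d E)%:R) <= #|` A|%:R].
Proof.
move=> /andP[eps0 eps1] D0.
have Dgt : 0 < #|` D|%:R :> R by rewrite ltr0n cardfs_gt0.
pose filled A (m : nat) :=
  [/\ (A `<=` E)%fset, (1 - eps) * (m%:R * #|` D|%:R) <= #|` A|%:R,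
      h A <= m%:R * h D & forall k, (boundary k A <= m * boundary k D)%N].
pose maximal A := forall c, (rtranslate D c `<=` E)%fset ->
  eps * #|` D|%:R <= #|` rtranslate D c `&` A|%fset%:R.
suff [A [m [[AE Am hA bA] Amax]]] : exists A m, filled A m /\ maximal A.
  exists A, m; split => //.
  rewrite -(ler_pM2l Dgt).
  pose C := [fset c in E | (rtranslate D c `<=` E)%fset]%fset.
  have : eps * #|` D|%:R * #|` C|%:R <= #|` D|%:R * #|` A|%:R.
    have := leq_sum_overlap A C D; rewrite -(ler_nat R) natrM.
    apply: le_trans.
    rewrite natr_sum [X in _ * X%:R]card_fset_sum1 natr_sum mulr_sumr !big_seq.
    apply: ler_sum => c; rewrite !inE => /andP[_ cE].
    by rewrite mulr1; exact: Amax.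
  have : #|` E|%:R <= #|` C|%:R + (\sum_(d <- D) boundary d E)%:R :> R.
    by rewrite -natrD ler_nat leq_centers.
  move=> ebc dca; apply: le_trans dca.
  by rewrite mulrCA mulrA ler_wpM2l ?lerBlDr ?mulr_ge0 // ltW.
(* As [eps < 1], each added translate makes [A] strictly larger. *)
suff step n A m : (#|` E| - #|` A| <= n)%N -> filled A m ->
    exists A m, filled A m /\ maximal A.
  apply: (step _ fset0 0%N) (leqnn _) _; split; rewrite ?mul0r ?fsub0set ?mulr0 //.
  move=> k; rewrite /boundary mul0n leqn0 cardfs_eq0.
  by apply/eqP/fsetP => x; rewrite !inE.
elim: n A m => [|n IH] A m EA fA.
  exists A, m; split => // c cE.
  have AE : A = E.
    case: fA => AE _ _ _; apply/eqP; rewrite eqEfcard AE /=.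
    by rewrite -subn_eq0 -leqn0.
  rewrite AE; move/fsetIidPl: cE => ->; rewrite card_rtranslate.
  by rewrite ger_pMl // ltW.
have [Amax|/existsNP[c /not_implyP[cE /negP]]] := pselect (maximal A).
  by exists A, m.
rewrite -ltNge => small; case: fA => AE Am hA bA.
have cardU : #|` A `|` rtranslate D c|%fset%:R =
    #|` A|%:R + #|` D|%:R - #|` rtranslate D c `&` A|%fset%:R :> R.
  apply/eqP; rewrite -(card_rtranslate D c) eq_sym subr_eq -!natrD.
  by rewrite [(_ `&` A)%fset]fsetIC cardfsUI.
have UE : (A `|` rtranslate D c `<=` E)%fset by rewrite fsubUset AE.
apply: (IH (A `|` rtranslate D c)%fset m.+1); last split => //.
- have ltA : (#|` A| < #|` A `|` rtranslate D c|%fset)%N.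
    rewrite -(ltr_nat R) cardU -addrA ltrDl subr_gt0.
    by apply: lt_trans small _; rewrite gtr_pMl.
  move: EA; rewrite -ltnS; move: (fsubset_leq_card UE).
  by move: ltA; lia.
- by rewrite cardU -natr1; move: small Am; lra.
- by rewrite -natr1 mulrDl mul1r; apply: le_trans (hU _ _) _; exact: lerD.
- move=> k; apply: leq_trans (boundaryU _ _ _) _.
  by rewrite boundary_rtranslate mulSn addnC leq_add.
Qed.

End Filling.

(** * The Ornstein-Weiss lemma *)

Section OrnsteinWeiss.
Variables (R : realType) (G : groupType) (h : {fset G} -> R).
Hypothesis h0 : h fset0 <= 0.
Hypothesis h_ge0 : forall A, 0 <= h A.
Hypothesis hU : forall A B, h (A `|` B)%fset <= h A + h B.
Hypothesis hT : forall A c, h (rtranslate A c) <= h A.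
Implicit Types (A B C D E K : {fset G}).

Definition almost_invariant K (delta : R) E :=
  forall k, k \in K -> (boundary k E)%:R <= delta * #|` E|%:R.

(** The sets of a Folner sequence eventually satisfy any such invariance
    condition, so that [a] bounds the limit superior of [h] per element. *)
Definition bounded_on_invariant (a : R) := exists K (delta : R),
  0 < delta /\ forall E, almost_invariant K delta E -> h E <= a * #|` E|%:R.

Lemma le_card_mul E : h E <= h [fset 1%g]%fset * #|` E|%:R.
Proof.
elim/finSet_rect: E => E IH.
have [->|[x xE]] := fset_0Vmem E; first by rewrite cardfs0 mulr0.
rewrite -(fsetD1K xE); apply: le_trans (hU _ _) _.
have -> : #|` x |` (E `\ x)|%fset%:R = 1 + #|` E `\ x|%fset%:R :> R.
  by rewrite fsetD1K // (cardfsD1 x) xE natrD.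
rewrite mulrDr mulr1 lerD //; last first.
  by apply: IH; rewrite fproperD1.
suff -> : [fset x]%fset = rtranslate [fset 1%g]%fset x by exact: hT.
by apply/fsetP => y; rewrite mem_rtranslate !inE -divg_eq1.
Qed.

(** Fill [E] by translates of [D] up to overlaps of proportion [eps]: this costs
    at most [alpha] per point, and uses up half of the proportion [eps] of [E].
    The rest of [E] either is negligible or, having a boundary that is small
    relatively to [E], inherits the current bound. *)
Lemma bounded_on_invariant_step (l alpha eps eta rho : R) :
  0 < eps < 1 -> 0 < eta -> 0 <= rho -> 0 <= l -> l <= alpha * (1 - eps) ->
  (forall K (delta : R), 0 < delta ->
    exists D, [/\ D != fset0, almost_invariant K delta D & h D <= l * #|` D|%:R]) ->
  bounded_on_invariant (alpha + rho) ->
  bounded_on_invariant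
    (alpha + Num.max (rho * (1 - eps / 2)) (h [fset 1%g]%fset * eta)).
Proof.
move=> /andP[eps0 eps1] eta0 rho0 l0 lalpha exD [K [delta [delta0 hK]]].
have e1 : 0 < 1 - eps by rewrite subr_gt0.
have [|D [D0 Dinv hD]] := exD K (delta * eta * (1 - eps) / 2).
  by rewrite divr_gt0 ?mulr_gt0.
have Dgt : 0 < #|` D|%:R :> R by rewrite ltr0n cardfs_gt0.
(* The first bound makes the bad centers of [D] at most half of [E]; the second
   one makes the boundary of [E] small with respect to the unfilled part. *)
pose delta2 := Num.min ((#|` D|%:R)^-1 / 2) (delta * eta / 2).
have delta20 : 0 < delta2.
  by rewrite lt_min !divr_gt0 ?invr_gt0 ?mulr_gt0.
have delta2D : delta2 * #|` D|%:R <= 1 / 2.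
  by rewrite -ler_pdivlMr // mul1r [2^-1 * _]mulrC ge_min lexx.
have delta2e : delta2 <= delta * eta / 2 by rewrite ge_min lexx orbT.
exists (K `|` D)%fset, delta2; split => // E Einv.
have eps01 : 0 < eps < 1 by rewrite eps0.
have [A [m [AE Am hA bA Afill]]] := greedy_filling h0 hU hT E eps01 D0.
have AleE : #|` A|%:R <= #|` E|%:R :> R by rewrite ler_nat fsubset_leq_card.
have Bcard : #|` E `\` A|%fset%:R = #|` E|%:R - #|` A|%:R :> R.
  by rewrite cardfsDS // natrB // fsubset_leq_card.
have alpha0 : 0 <= alpha.
  by rewrite -(pmulr_lge0 _ e1) (le_trans l0).
have Ahalf : eps / 2 * #|` E|%:R <= #|` A|%:R.
  apply: le_trans Afill; rewrite -mulrA (ler_wpM2l (ltW eps0)) //.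
  suff : (\sum_(d <- D) boundary d E)%:R <= 1 / 2 * #|` E|%:R :> R by lra.
  apply: le_trans (ler_wpM2r _ delta2D) => //.
  rewrite natr_sum mulrAC (card_fset_sum1 D) natr_sum mulr_sumr big_seq.
  rewrite [leRHS]big_seq; apply: ler_sum => d dD; rewrite mulr1.
  by apply: Einv; rewrite inE dD orbT.
have hAle : h A <= alpha * #|` A|%:R.
  apply: le_trans hA _; apply: le_trans (_ : m%:R * (l * #|` D|%:R) <= _).
    by rewrite ler_wpM2l.
  apply: le_trans (ler_wpM2l alpha0 Am).
  have := ler_wpM2r (mulr_ge0 (ler0n R m) (ltW Dgt)) lalpha; lra.
have hE : h E <= h A + h (E `\` A)%fset.
  by rewrite -{1}(fsetID A E) (fsetIidPr AE); exact: hU.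
have [small|large] := leP #|` E `\` A|%fset%:R (eta * #|` E|%:R).
  apply: le_trans hE _; rewrite mulrDl lerD //.
    by apply: le_trans hAle _; rewrite ler_wpM2l.
  apply: le_trans (le_card_mul _) _.
  apply: le_trans (_ : h [fset 1%g]%fset * eta * #|` E|%:R <= _).
    by rewrite -mulrA ler_wpM2l.
  by rewrite ler_wpM2r // le_max lexx orbT.
have hB : h (E `\` A)%fset <= (alpha + rho) * #|` E `\` A|%fset%:R.
  apply: hK => k kK.
  apply: le_trans (_ : delta * (eta * #|` E|%:R) <= _); last first.
    by rewrite ler_wpM2l // ltW.
  apply: le_trans (_ : (boundary k E + m * boundary k D)%:R <= _).
    by rewrite ler_nat (leq_trans (boundaryD _ _ _)) // leq_add2l.
  rewrite natrD natrM.
  have : (boundary k E)%:R <= delta2 * #|` E|%:R by apply: Einv; rewrite inE kK.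
  have := ler_wpM2r (ler0n R #|` E|) delta2e.
  have := ler_wpM2l (ler0n R m) (Dinv k kK).
  have := ler_wpM2l (mulr_ge0 (ltW delta0) (ltW eta0)) (le_trans Am AleE).
  lra.
apply: le_trans hE _.
apply: le_trans (_ : (alpha + rho * (1 - eps / 2)) * #|` E|%:R <= _); last first.
  by rewrite ler_wpM2r // lerD2l le_max lexx.
have := ler_wpM2l rho0 Ahalf; move: hB hAle; rewrite Bcard; lra.
Qed.

(** Each step multiplies the excess over [alpha] by [1 - eps / 2], up to an error
    [M * eta]. The constants are chosen so that [alpha] is halfway between [l]
    and [a] and [M * eta] is at most the remaining half. *)
Lemma bounded_on_invariant_lt (l a : R) : 0 < l -> l < a ->
  (forall K (delta : R), 0 < delta ->
    exists D, [/\ D != fset0, almost_invariant K delta D & h D <= l * #|` D|%:R]) ->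
  bounded_on_invariant a.
Proof.
move=> l0 la exD; set M := h [fset 1%g]%fset.
have M0 : 0 <= M by exact: h_ge0.
pose alpha := (l + a) / 2.
have alpha0 : 0 < alpha by rewrite /alpha; lra.
pose eps := 1 - l / alpha.
have eps01 : 0 < eps < 1.
  rewrite subr_gt0 ltr_pdivrMr // mul1r gtrBl divr_gt0 // andbT /alpha; lra.
have lalpha : l <= alpha * (1 - eps).
  by rewrite /eps opprB addrC subrK mulrC divfK // gt_eqF.
pose eta := (a - l) / 2 / (M + 1).
have M1 : 0 < M + 1 by rewrite ltr_wpDl.
have eta0 : 0 < eta by rewrite !divr_gt0 // subr_gt0.
have Meta : M * eta <= (a - l) / 2.
  rewrite /eta mulrCA ger_pMr; last by rewrite divr_gt0 // subr_gt0.
  by rewrite ler_pdivrMr // mul1r lerDl.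
pose q := 1 - eps / 2.
have q01 : 0 <= q < 1 by rewrite /q; move: eps01; lra.
have mono (b c : R) : b <= c -> bounded_on_invariant b -> bounded_on_invariant c.
  move=> bc [K [delta [delta0 hK]]]; exists K, delta; split => // E /hK.
  by move=> /le_trans; apply; rewrite ler_wpM2r.
have iter s : bounded_on_invariant (alpha + Num.max (M * q ^+ s) (M * eta)).
  elim: s => [|s IH].
    exists fset0, 1; split => // E _; apply: le_trans (le_card_mul _) _.
    rewrite ler_wpM2r // expr0 mulr1; apply: ler_wpDl; first exact: ltW.
    by rewrite le_max lexx.
  have rho0 : 0 <= Num.max (M * q ^+ s) (M * eta).
    by rewrite le_max mulr_ge0 // exprn_ge0 // (andP q01).1.
  have := bounded_on_invariant_step eps01 eta0 rho0 (ltW l0) lalpha exD IH.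
  apply: mono; rewrite lerD2l -/q -/M ge_max; apply/andP; split; last first.
    by rewrite le_max lexx orbT.
  case/andP: q01 => q0 q1; rewrite maxr_pMl // -mulrA -exprSr ge_max.
  rewrite le_max lexx /= le_max (_ : M * eta * q <= M * eta) ?orbT //.
  by apply: ler_piMr (ltW q1); exact: mulr_ge0 M0 (ltW eta0).
have [s qs] : exists s, q ^+ s < eta.
  have := cvg_expr (_ : `|q| < 1); rewrite ger0_norm ?(andP q01).1 //.
  move=> /(_ (andP q01).2)/cvgr0Pnorm_lt/(_ _ eta0)[s _ /(_ s (leqnn s))].
  by rewrite /= normrX ger0_norm ?(andP q01).1 //; exists s.
apply: mono (iter s).
have -> : Num.max (M * q ^+ s) (M * eta) = M * eta.
  by apply/max_idPr; rewrite ler_wpM2l // ltW.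
by rewrite /alpha; move: Meta; lra.
Qed.

Variable F : nat -> {fset G}.
Hypothesis F_folner : is_folner R F.

Lemma folner_almost_invariant K (delta : R) : 0 < delta ->
  \forall n \near \oo, almost_invariant K delta (F n).
Proof.
move=> delta0; case: F_folner => F0 FK.
have := @filter_bigI _ _ K
  (fun k => [set n | (boundary k (F n))%:R <= delta * #|` F n|%:R]) \oo _ _.
case=> [k _|N _ HN].
  have := FK [fset k]%fset; rewrite -cardfs_eq0 cardfs1 => /(_ isT).
  move=> /cvgr0Pnorm_lt/(_ _ delta0); apply: filterS => n /=.
  have Fn : 0 < #|` F n|%:R :> R by rewrite ltr0n cardfs_gt0.
  rewrite ger0_norm ?divr_ge0 // ltr_pdivrMr // => /ltW; apply: le_trans.
  rewrite ler_nat -[X in (X <= _)%N](card_ltranslate k); apply: fsubset_leq_card.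
  apply/fsubsetP => _ /imfsetP[x /= + ->]; rewrite !inE => /andP[xF ->] /=.
  by apply/orP; left; apply/imfset2P; exists k; rewrite ?inE //; exists x.
by exists N => // n /HN /= H k kK; exact: H.
Qed.

(** The Ornstein-Weiss lemma: no limit point of the sequence can exceed another
    one, since a single very invariant [F n] with a small value bounds the
    values at all sufficiently invariant sets. *)
Lemma ornstein_weiss : cvgn (fun n => (#|` F n|%:R)^-1 * h (F n)).
Proof.
set u := (X in cvgn X); set M := h [fset 1%g]%fset.
have Fgt n : 0 < #|` F n|%:R :> R by rewrite ltr0n cardfs_gt0; case: F_folner.
have u_ge0 n : 0 <= u n by rewrite mulr_ge0 // invr_ge0 ltW.
have u_leM n : u n <= M by rewrite /u mulrC ler_pdivrMr // le_card_mul.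
(* [sup S] is the limit inferior of [u]. *)
pose S := [set a : R | \forall n \near \oo, a <= u n].
have S0 : S 0 by apply: nearW.
have SM : has_ubound S.
  exists M => a [N _ /(_ N (leqnn N))] /= /le_trans; exact.
apply/cvg_ex; exists (sup S); apply/cvgrPdist_le => e e0.
have sup0 : 0 <= sup S by exact: ub_le_sup.
have [a Sa sa] : exists2 a, S a & sup S - e < a.
  by apply: sup_adherent => //; split => //; exists 0.
have freq N : exists2 n, (N <= n)%N & u n < sup S + e / 2.
  apply: contrapT => H; have : S (sup S + e / 2).
    exists N => // n /= Nn; rewrite leNgt; apply/negP => un.
    by apply: H; exists n.
  by move/(ub_le_sup SM); lra.
have [] := @bounded_on_invariant_lt (sup S + e / 2) (sup S + e).
- lra.
- lra.
- move=> K delta delta0.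
  have [N _ HN] := folner_almost_invariant K delta0.
  have [n Nn un] := freq N; exists (F n); split; first by case: F_folner.
    exact: HN.
  by rewrite -ler_pdivrMr // mulrC ltW.
move=> K [delta [delta0 hK]].
near=> n.
have : a <= u n by near: n.
have : u n <= sup S + e.
  rewrite /u mulrC ler_pdivrMr //; apply: hK.
  by near: n; exact: folner_almost_invariant.
rewrite ler_norml; lra.
Unshelve. all: by end_near. Qed.

End OrnsteinWeiss.

(** * Cover numbers of joint covers *)

Section Subcovers.
Variable Y : Type.
Implicit Types (V : set (set Y)) (n : nat).

Definition covering (I : Type) (f : I -> set Y) := forall y, exists i, f i y.

Lemma subcover_card_family V n : subcover_card V n ->
  exists2 f : 'I_n -> set Y, covering f & forall i, V (f i).
Proof.
case=> W [WV /card_esym cW WT].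
have /pcard_eqP/bijPex[f [fW _ fsurj]] : [set: 'I_n] #= W.
  by apply: card_eq_trans cW; apply/card_esym; exact: card_II.
exists f => [y|i]; last exact/WV/fW.
have : (\bigcup_(B in W) B) y by rewrite WT.
by case=> B /fsurj[i _ <-] iy; exists i.
Qed.

(** Choosing for each [f i] a member of [V] that contains it gives a subcover;
    different [i] may yield the same member, hence only an inequality. *)
Lemma family_subcover_card V (I : finType) (f : I -> set Y) : covering f ->
  (forall i, exists2 B, V B & f i `<=` B) ->
  exists2 n, (n <= #|I|)%N & subcover_card V n.
Proof.
move=> fcov fV.
have /choice[B BV] : forall i, exists B, V B /\ f i `<=` B.
  by move=> i; have [B ? ?] := fV i; exists B.
pose W := range (B \o enum_val : 'I_#|I| -> _).
have WI : W #<= `I_#|I|.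
  have /card_eqPle[_ leI] := @card_II #|I|.
  exact: card_le_trans (card_image_le _ _) leI.
have [n Wn] : finite_set W by apply/finite_set_leP; exists #|I|.
exists n.
  rewrite -card_le_II; apply: card_le_trans WI.
  by move: Wn; rewrite card_eq_le => /andP[].
exists W; split => // [_ [i _ <-]|]; first by case: (BV (enum_val i)).
apply/seteqP; split => // y _; have [i iy] := fcov y.
exists (B i); last by case: (BV i) => _; apply.
by exists (enum_rank i) => //=; rewrite enum_rankK.
Qed.

Lemma min_subcoverP V : (exists n, subcover_card V n) ->
  subcover_card V (min_subcover V) /\
  forall m, subcover_card V m -> (min_subcover V <= m)%N.
Proof.
move=> [n Vn]; apply: (getPex (P := [set n | subcover_card V n /\ _])).
have exV : exists n, `[< subcover_card V n >] by exists n; apply/asboolP.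
exists (ex_minn exV); case: ex_minnP => m /asboolP Vm mmin; split => // k Vk.
by apply: mmin; apply/asboolP.
Qed.

Lemma min_subcover_le V (I : finType) (f : I -> set Y) : covering f ->
  (forall i, exists2 B, V B & f i `<=` B) -> (min_subcover V <= #|I|)%N.
Proof.
move=> fcov fV; have [n nI Vn] := family_subcover_card fcov fV.
have [_ minV] := min_subcoverP (ex_intro _ n Vn).
exact: leq_trans (minV _ Vn) nI.
Qed.

Lemma card_le_min_subcover V (I : finType) (p : I -> Y) :
  (exists n, subcover_card V n) ->
  (forall B i j, V B -> B (p i) -> B (p j) -> i = j) ->
  (#|I| <= min_subcover V)%N.
Proof.
move=> /min_subcoverP[/subcover_card_family[f fcov fV] _] sep.
have /choice[k kP] : forall i, exists k, f k (p i) by move=> i; exact: fcov.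
rewrite -[min_subcover V]card_ord; apply: (@leq_card _ _ k) => i j kij.
by apply: (sep (f (k i))) => //; rewrite kij.
Qed.

End Subcovers.

(** Compactness is used as a near-covering property, for the filter generated by
    the finite subfamilies of [U]. *)
Lemma compact_finite_subcover (Y : topologicalType) (U : set (set Y)) :
  compact [set: Y] -> open_cover U -> exists n, subcover_card U n.
Proof.
move=> /compact_near_coveringP cptY [Uo UT].
pose D := [set W | finite_set W /\ W `<=` U].
pose above W : set (set (set Y)) := [set W' | W `<=` W'].
have FF : Filter (filter_from D above).
  apply: filter_from_filter; first by exists set0; split => //; exact: sub0set.
  move=> W1 W2 [fW1 W1U] [fW2 W2U]; exists (W1 `|` W2).
    by split; [rewrite finite_setU | rewrite subUset].
  by move=> W; rewrite /above /= subUset.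
have [y _|W [[n Wn] WU]] := cptY _ _ (fun W y => (\bigcup_(B in W) B) y) FF.
  have : (\bigcup_(B in U) B) y by rewrite UT.
  case=> B UB By; exists (B, above [set B]); first split => /=.
  - by apply: open_nbhs_nbhs; split => //; exact: Uo.
  - by exists [set B] => //; split; [exact: finite_set1 | move=> _ ->].
  by move=> [z W] /= [Bz BW]; exists B => //; exact: BW.
move=> /(_ W (@subset_refl _ W)) WT; exists n; exists W; split => //.
by apply/seteqP; split => // y _; exact: WT.
Qed.

Section JoinCovers.
Variables (R : realType) (G : groupType) (Y : topologicalType).
Variables (S : G -> Y -> Y) (U : set (set Y)).
Hypothesis S_action : is_continuous_action S.
Hypothesis Y_compact : compact [set: Y].
Hypothesis U_cover : open_cover U.
Implicit Types (D E : {fset G}).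

Lemma mem_join_cover D (W : G -> set Y) y :
  (\bigcap_(g in [set` D]) (S g^-1%g @` W g)) y <->
  forall g, g \in D -> W g (S g y).
Proof.
have [S1 SM _] := S_action.
split=> [H g gD|H g /= gD].
  have [z Wz <-] := H g gD; by rewrite -SM mulgV S1.
by exists (S g y); [exact: H | rewrite -SM mulVg S1].
Qed.

Lemma finite_join_cover D : exists n, subcover_card (join_cover S D U) n.
Proof.
have [n /subcover_card_family[f fcov fU]] :=
  compact_finite_subcover Y_compact U_cover.
pose F (w : {ffun D -> 'I_n}) : set Y :=
  [set y | forall g : D, f (w g) (S (val g) y)].
have [||N _] := @family_subcover_card _ (join_cover S D U) _ F; last by exists N.
  move=> y; have /choice[k kP] : forall g : D, exists i, f i (S (val g) y).
    by move=> g; exact: fcov.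
  by exists [ffun g => k g] => g; rewrite ffunE.
(* If [n = 0] then [Y] is empty, and so are all the members of the cover. *)
move=> w; have [i0|no] := pselect (exists i : 'I_n, True); last first.
  exists (F w); last by [].
  exists (fun g => set0) => [g gD|]; first by case: no; exists (w [` gD]%fset).
  apply/seteqP; split => y.
    by move/mem_join_cover => H g; case: (H _ (valP g)).
  by move=> _; apply/mem_join_cover => g gD; case: no; exists (w [` gD]%fset).
case: i0 => i0 _.
pose W g := if insub g is Some g' then f (w g') else f i0.
exists (\bigcap_(g in [set` D]) (S g^-1%g @` W g)).
  by exists W => // g gD; rewrite /W insubT; exact: fU.
move=> y Fy; apply/mem_join_cover => g gD; rewrite /W insubT.
exact: (Fy (Sub g gD)).
Qed.

Definition cover_number D := min_subcover (join_cover S D U).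

Lemma join_cover_family D : exists2 f : 'I_(cover_number D) -> set Y,
  covering f & forall i, join_cover S D U (f i).
Proof.
by apply: subcover_card_family; case: (min_subcoverP (finite_join_cover D)).
Qed.

Lemma cover_number0 : (cover_number fset0 <= 1)%N.
Proof.
rewrite -[1%N]card_unit; apply: (min_subcover_le (f := fun _ => setT)) => [y|_].
  by exists tt.
exists (\bigcap_(g in [set` (fset0 : {fset G})]) (S g^-1%g @` setT)).
  by exists (fun _ => setT) => // g; rewrite inE.
by move=> y _; apply/mem_join_cover => g; rewrite inE.
Qed.

Lemma cover_numberU D E :
  (cover_number (D `|` E)%fset <= cover_number D * cover_number E)%N.
Proof.
have [f fcov fD] := join_cover_family D; have [e ecov eE] := join_cover_family E.
rewrite -[X in (_ <= X * _)%N]card_ord -[X in (_ <= _ * X)%N]card_ord -card_prod.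
apply: (min_subcover_le (f := fun i => f i.1 `&` e i.2)) => [y|[i j] /=].
  by have [i ?] := fcov y; have [j ?] := ecov y; exists (i, j).
have [V VU <-] := fD i; have [W WU <-] := eE j.
pose VW g := if g \in D then V g else W g.
exists (\bigcap_(g in [set` (D `|` E)%fset]) (S g^-1%g @` VW g)).
  exists VW => // g; rewrite inE /VW.
  by case: ifP => [gD _|_ /=]; [exact: VU | exact: WU].
move=> y [/mem_join_cover Vy /mem_join_cover Wy]; apply/mem_join_cover => g.
rewrite inE /VW; case: ifP => [gD _|_ /=]; [exact: Vy | exact: Wy].
Qed.

(** Membership in the joint cover over [rtranslate D c] at [y] is membership in
    the joint cover over [D] at [S c y]. *)
Lemma cover_number_rtranslate D c :
  (cover_number (rtranslate D c) <= cover_number D)%N.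
Proof.
have [S1 SM _] := S_action.
have [f fcov fD] := join_cover_family D; rewrite -[leqRHS]card_ord.
apply: (min_subcover_le (f := fun i => [set y | f i (S c y)])) => [y|i].
  exact: fcov.
have [W WU <-] := fD i.
exists (\bigcap_(g in [set` rtranslate D c])
    (S g^-1%g @` W (g * c^-1)%g)).
  by exists (fun g => W (g * c^-1)%g) => // g; rewrite mem_rtranslate; exact: WU.
move=> y /= /mem_join_cover Wy; apply/mem_join_cover => g.
by rewrite mem_rtranslate => /Wy; rewrite -SM mulgVK.
Qed.

Lemma cover_entropy_cvg (F : nat -> {fset G}) : is_folner R F -> inhabited Y ->
  cvgn (fun n => (#|` F n|%:R)^-1 * ln (cover_number (F n))%:R : R).
Proof.
move=> FF [y0].
have N_gt0 D : (0 < cover_number D)%N.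
  have [f fcov _] := join_cover_family D.
  by have [i _] := fcov y0; exact: leq_ltn_trans (leq0n i) (ltn_ord i).
have ln_mono m n : (0 < m)%N -> (m <= n)%N -> ln m%:R <= ln n%:R :> R.
  move=> m0 mn; rewrite ler_ln ?ler_nat ?posrE ?ltr0n //.
  exact: leq_trans mn.
apply: (ornstein_weiss (h := fun D => ln (cover_number D)%:R)) => //.
- by rewrite ln_le0 // lern1 cover_number0.
- by move=> D; rewrite ln_ge0 // ler1n.
- move=> D E; rewrite -lnM ?posrE ?ltr0n // -natrM.
  by apply: ln_mono => //; exact: cover_numberU.
- by move=> D c; apply: ln_mono => //; exact: cover_number_rtranslate.
Qed.

End JoinCovers.

(** * Factors of the full shift and asymptotic pairs *)

Section FullShift.
Variables (G : groupType) (A : alphabetType).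
Implicit Types (x y z : fullshift G A) (D E : {fset G}).

Definition agree_on D x y := forall h, h \in D -> x h = y h.

Lemma restr_eqP D x y : restr D x = restr D y <-> agree_on D x y.
Proof.
split=> [/ffunP xy h hD|xy]; first by have := xy [` hD]%fset; rewrite !ffunE.
by apply/ffunP => h; rewrite !ffunE; apply: xy; exact: valP.
Qed.

Lemma nbhs_fullshiftP x (U : set (fullshift G A)) :
  nbhs x U <-> exists D, agree_on D x `<=` U.
Proof.
split=> [|[D DU]].
  move=> [] P [] [] Q QfinP <- [] V JV Vx VU.
  have [L Lsub VL] := QfinP _ JV.
  have /choice[w wP] : forall M, exists w : G, M \in L ->
      exists N : set A, (fun f : fullshift G A => f w) @^-1` N = M.
    move=> M; have [ML|] := boolP (M \in L); last by exists 1%g.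
    by have /Lsub/set_mem[w _ [N _ <-]] := ML; exists w => _; exists N.
  exists [fset w M | M in L]%fset => y xy; apply: VU; exists V => //.
  rewrite -VL in Vx *; move=> M ML; have [N NM] := wP M ML.
  have := Vx M ML; rewrite -NM /= xy //.
  by apply/imfsetP; exists M.
apply: filterS DU _.
have agreeh h : nbhs x [set y : fullshift G A | x h = y h].
  have nh := @proj_continuous _ (fun _ : G => discrete_topology A) h x
    [set x h] (discrete_set1 _).
  apply: (@filterS _ (nbhs x) _
      (@proj _ (fun _ : G => discrete_topology A) h @^-1` [set x h])).
    by move=> y yh; exact: esym yh.
  exact: nh.
exact: (@filter_bigI _ _ D _ (nbhs x) _ (fun h _ => agreeh h)).
Qed.

Lemma open_agree_on D x : open (agree_on D x).
Proof.
rewrite openE => y xy; apply/nbhs_fullshiftP; exists D => z yz h hD.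
by rewrite (xy h hD) (yz h hD).
Qed.

Lemma compact_fullshift : compact [set: fullshift G A].
Proof.
have := @tychonoff G (fun _ => discrete_topology A) (fun _ => setT).
rewrite (_ : [set f | _] = setT); last by apply/seteqP.
by apply=> _; apply: finite_compact; exact: (@finite_finset A).
Qed.

(** Continuity at a point gives a finite set that depends on the point;
    compactness makes it uniform, the finite sets being filtered by inclusion. *)
Lemma uniform_continuity (R : realType) (Y : metricType R)
    (X : set (fullshift G A)) (phi : fullshift G A -> Y) (eps : R) :
  closed X -> {within X, continuous phi} -> 0 < eps ->
  exists D, forall x y, X x -> X y -> agree_on D x y ->
    mdist (phi x) (phi y) < eps.
Proof.
move=> Xcl /subspace_continuousP phic eps0.
have Xcpt : compact X by exact: subclosed_compact Xcl compact_fullshift _.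
pose above D : set {fset G} := [set E | (D `<=` E)%fset].
have FF : Filter (filter_from setT above).
  apply: filter_from_filter; first by exists fset0.
  move=> D1 D2 _ _; exists (D1 `|` D2)%fset => // D.
  by rewrite /above /= fsubUset => /andP[].
pose P D x := forall y, X x -> X y -> agree_on D x y ->
  mdist (phi x) (phi y) < eps.
have [x Xx|D _] := (compact_near_coveringP X).1 Xcpt _ _ P FF; last first.
  move=> /(_ D (fsubset_refl D)) DP; exists D => x y Xx; exact: DP.
have e2 : 0 < eps / 2 by rewrite divr_gt0.
have [D DP] := (nbhs_fullshiftP _ _).1 (phic x Xx _ (nbhsx_ballx (phi x) _ e2)).
exists (agree_on D x, above D).
  by split; [apply/nbhs_fullshiftP; exists D | exists D].
move=> [x' E] [/= xx' DE] y Xx' Xy x'y.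
have dist z : X z -> agree_on D x z -> mdist (phi x) (phi z) < eps / 2.
  by move=> Xz xz; have := DP z xz Xz; rewrite /= ballEmdist.
have := dist x' Xx' xx'; have := dist y Xy.
have xy : agree_on D x y.
  by move=> h hD; rewrite (xx' h hD) (x'y h) // (fsubsetP DE).
move=> /(_ xy); have := metric_triangle (phi x') (phi x) (phi y).
by rewrite (metric_sym (phi x') (phi x)); lra.
Qed.

(** Along an exchange chain the image under [phi] only moves when one passes from
    a configuration to another one with the same pattern on [D], hence at most
    [N.+1] times, each time by less than [eps]; as [N] does not depend on [D],
    [eps] can be taken arbitrarily small. *)
Lemma BCE_separates_asymptotic_pair (R : realType) (Y : metricType R)
    (X : set (fullshift G A)) (phi : fullshift G A -> Y) (a b : fullshift G A) :
  closed X -> {within X, continuous phi} -> BCE X ->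
  X a -> X b -> phi a <> phi b ->
  exists x y, [/\ X x, X y, asymptotic x y & phi x <> phi y].
Proof.
move=> Xcl phic [N chain] Xa Xb phiab; apply: contrapT => noasym.
have phi_asym x y : X x -> X y -> asymptotic x y -> phi x = phi y.
  by move=> *; apply: contrapT => ?; apply: noasym; exists x, y.
have d0 : 0 < mdist (phi a) (phi b) by rewrite mdist_gt0; exact/eqP.
pose eps := mdist (phi a) (phi b) / N.+1%:R.
have eps0 : 0 < eps by rewrite divr_gt0 ?ltr0n.
have [D Dphi] := uniform_continuity Xcl phic eps0.
have [||r [r0 rN rex]] := chain D (restr D a) (restr D b).
- by exists a.
- by exists b.
suff close i z : (i <= N)%N -> X z -> restr D z = r i ->
    mdist (phi a) (phi z) < i.+1%:R * eps.
  have := close N b (leqnn N) Xb (esym rN).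
  by rewrite /eps mulrC divfK ?ltxx // pnatr_eq0.
elim: i z => [|i IH] z iN Xz zr.
  by rewrite mul1r; apply: Dphi => //; apply/restr_eqP; rewrite zr.
have [x [y [Xx Xy xy xr yr]]] := rex i iN.
apply: le_lt_trans (metric_triangle _ (phi x) _) _.
rewrite -natr1 mulrDl mul1r ltrD //; first exact: IH (ltnW iN) Xx xr.
by rewrite (phi_asym x y) //; apply: Dphi => //; apply/restr_eqP; rewrite zr.
Qed.

End FullShift.

(** * Frequent occurrences of a pattern *)

Section Multiplicity.
Local Open Scope ereal_scope.

(** The mean over [X] of the number of [B j] containing a point is at least
    [alpha * #|F|], so that some point of [X] reaches this value. *)
Lemma exists_large_multiplicity (d : measure_display) (T : measurableType d)
    (R : realType) (mu : probability T R) (X : set T) (J : choiceType)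
    (F : {fset J}) (B : J -> set T) (alpha : R) :
  measurable X -> mu X = 1 ->
  (forall j, measurable (B j)) -> (forall j, alpha%:E <= mu (B j)) ->
  exists2 x, X x &
    (alpha * #|` F|%:R <= #|` [fset j in F | `[< B j x >]]|%fset%:R)%R.
Proof.
move=> mX X1 mB alphaB.
pose mult x := #|` [fset j in F | `[< B j x >]]|%fset.
have [x0 Xx0] : X !=set0.
  apply/set0P/eqP => X0; move: X1; rewrite X0 measure0 => /eqP.
  by rewrite eqe eq_sym oner_eq0.
have exm : exists m, `[< exists2 x, X x & mult x = m >].
  by exists (mult x0); apply/asboolP; exists x0.
have mub m : `[< exists2 x, X x & mult x = m >] -> (m <= #|` F|)%N.
  move=> /asboolP[x _ <-]; apply: fsubset_leq_card.
  by apply/fsubsetP => j; rewrite !inE => /andP[].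
have [m /asboolP[x Xx xm] mmax] := ex_maxnP exm mub.
exists x => //; rewrite -/(mult x) xm -lee_fin.
have XC0 : mu (~` X) = 0 by rewrite probability_setC // X1 subee.
have BX j : mu (B j) = mu (B j `&` X).
  have mBX : measurable (B j `&` ~` X).
    by apply: measurableI => //; exact: measurableC.
  rewrite -[in LHS](setIT (B j)) -(setUv X) setIUr measureU0 //.
    exact: measurableI.
  apply: (@subset_measure0 _ _ _ _ _ (~` X)) => //; first exact: measurableC.
apply: le_trans (_ : \sum_(j <- F) mu (B j `&` X) <= _).
  apply: le_trans (_ : \sum_(j <- F) alpha%:E <= _); last first.
    by apply: lee_sum => j _; rewrite -BX.
  rewrite sumEFin lee_fin card_fset_sum1 natr_sum mulr_sumr.
  by under eq_bigr do rewrite mulr1.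
have -> : \sum_(j <- F) mu (B j `&` X) =
    \int[mu]_(x in X) (\sum_(j <- F) (\1_(B j) x)%:E).
  rewrite ge0_integral_sum //.
    by apply: eq_bigr => j _; rewrite integral_indic.
  by move=> j; apply/measurable_EFinP; exact: measurable_indic.
apply: le_trans (_ : \int[mu]_(x in X) cst m%:R%:E x <= _); last first.
  by rewrite integral_cst // -[leRHS]mule1 -X1.
apply: ge0_le_integral => //.
- by move=> y _; apply: sume_ge0 => j _; rewrite lee_fin.
- apply: emeasurable_sum => j; apply/measurable_EFinP; exact: measurable_indic.
move=> y Xy; rewrite sumEFin lee_fin.
have -> : (\sum_(j <- F) \1_(B j) y = (mult y)%:R :> R)%R.
  rewrite /mult card_sep_sum natr_sum; apply: eq_bigr => j _.
  by rewrite indicE; congr (nat_of_bool _)%:R; apply/idP/asboolP; rewrite inE.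
by rewrite ler_nat; apply: mmax; apply/asboolP; exists y.
Qed.

End Multiplicity.

Section DisjointTranslates.
Variable G : groupType.
Implicit Types (E F T : {fset G}).

(** The sets in question are the left translates of [E] by the inverses of the
    elements of [T]: an occurrence of a pattern on [E] located at [g] occupies
    the translate by [g^-1]. *)
Definition disjoint_translates E T := forall g g' h, g \in T -> g' \in T ->
  (g * h)%g \in E -> (g' * h)%g \in E -> g = g'.

(** Greedy choice: a chosen [g] excludes only the elements of [rtranslate Q g],
    where [Q] is the set of the [x * y^-1] with [x] and [y] in [E]. *)
Lemma exists_disjoint_translates E : E != fset0 -> exists2 q, (0 < q)%N &
  forall F, exists T,
    [/\ (T `<=` F)%fset, disjoint_translates E T & (#|` F| <= #|` T| * q)%N].
Proof.
move=> /fset0Pn[e eE].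
pose Q := [fset (x * y^-1)%g | x in E, y in E]%fset.
have Q1 : 1%g \in Q by apply/imfset2P; exists e => //; exists e; rewrite ?mulgV.
exists #|` Q| => [|F]; first by rewrite cardfs_gt0; apply/fset0Pn; exists 1%g.
elim/finSet_rect: F => F IH.
have [->|[g gF]] := fset_0Vmem F.
  by exists fset0; split => // [|g ? ?]; rewrite ?cardfs0 // inE.
have [|T [TF Tsep FT]] := IH (F `\` rtranslate Q g)%fset.
  rewrite fproperE fsubsetDl; apply/fsubsetPn; exists g => //.
  by rewrite inE mem_rtranslate mulgV Q1.
have far g' : g' \in T -> g' \notin rtranslate Q g.
  by move=> /(fsubsetP TF); rewrite inE => /andP[].
have near_Q g' h : (g * h)%g \in E -> (g' * h)%g \in E -> g' \in rtranslate Q g.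
  move=> gh g'h; rewrite mem_rtranslate; apply/imfset2P.
  by exists (g' * h)%g => //; exists (g * h)%g => //; rewrite invgM mulgA mulgK.
exists (g |` T)%fset; split.
- rewrite fsubUset fsub1set gF /=; apply: fsubset_trans TF _.
  exact: fsubsetDl.
- move=> g1 g2 h; rewrite !inE => /orP[/eqP->|g1T] /orP[/eqP->|g2T] // gh g'h.
  + by have := far _ g2T; rewrite (near_Q _ _ gh g'h).
  + by have := far _ g1T; rewrite (near_Q _ _ g'h gh).
  + exact: Tsep gh g'h.
have gT : g \notin T.
  by apply/negP => /far; rewrite mem_rtranslate mulgV Q1.
rewrite cardfsU1 gT /= mulnDl mul1n -(cardfsID (rtranslate Q g) F) leq_add //.
by rewrite -(card_rtranslate Q g); apply/fsubset_leq_card/fsubsetIr.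
Qed.

End DisjointTranslates.

Section Occurrences.
Variables (R : realType) (G : groupType) (A : alphabetType).
Variable X : set (fullshift G A).
Implicit Types (x y z : fullshift G A) (E F : {fset G}).

Lemma measurable_open (U : set (fullshift G A)) :
  open U -> measurable (U : set (borel G A)).
Proof. by move=> Uo; exact: sub_sigma_algebra. Qed.

Lemma open_occurrence E x g : open [set z | agree_on E x (shift_act g z)].
Proof.
rewrite openE => z xz; apply/nbhs_fullshiftP.
exists [fset (g^-1 * h)%g | h in E]%fset => u zu h hE.
by rewrite (xz h hE) /shift_act zu //; apply/imfsetP; exists h.
Qed.

Lemma frequent_occurrences E x : closed X -> has_full_invariant_measure R X ->
  X x -> exists2 alpha : R, 0 < alpha & forall F, exists2 z, X z &
    alpha * #|` F|%:R <=
      #|` [fset g in F | `[< agree_on E x (shift_act g z) >]]|%fset%:R.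
Proof.
move=> Xcl [mu [X1 muinv muX]] Xx.
have mE : measurable (agree_on E x : set (borel G A)).
  by apply: measurable_open; exact: open_agree_on.
have mX : measurable (X : set (borel G A)).
  rewrite -[X]setCK; apply: measurableC; apply: measurable_open.
  exact: closed_openC.
have muE : (0 < mu (agree_on E x))%E.
  by have := Xx; rewrite -{1}muX; apply; [exact: open_agree_on | move=> h].
have fE : mu (agree_on E x) \is a fin_num by exact: fin_num_measure.
exists (fine (mu (agree_on E x))).
  by rewrite fine_gt0 // muE /= ltey_eq fE.
move=> F.
apply: (@exists_large_multiplicity _ (borel G A) R mu X G F
  (fun g => [set z | agree_on E x (shift_act g z)]) _ mX X1) => g.
  by apply: measurable_open; exact: open_occurrence.
by rewrite fineK // -(muinv g _ mE).
Qed.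

End Occurrences.

(** * Independent implants in a subshift of finite type *)

Section FiniteType.
Variables (G : groupType) (A : alphabetType) (X : set (fullshift G A)).
Implicit Types (x y z w : fullshift G A) (D E K M T : {fset G}).

Lemma shift_act1 x : shift_act 1%g x = x.
Proof. by apply/funext => h; rewrite /shift_act invg1 mul1g. Qed.

(** The window is the union of the supports of the forbidden patterns. *)
Lemma SFT_window : is_SFT X -> exists M, forall z,
  (forall g, exists2 w, X w & agree_on M w (shift_act g z)) -> X z.
Proof.
case=> P Pfin XP.
exists (\bigcup_(p <- fset_set P) tag p)%fset => z zw.
rewrite XP => p Pp [g zg]; have [w Xw wz] := zw g.
move: Xw; rewrite XP => /(_ p Pp); apply; exists 1%g; rewrite shift_act1 -zg.
apply/restr_eqP => h hp; apply: wz.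
by apply/bigfcupP; exists p => //; rewrite andbT in_fset_set // inE.
Qed.

(** The first element of the filtered sequence is used; there is at most one when
    the translates are disjoint. *)
Definition implant E T y z : fullshift G A := fun h =>
  if ohead [seq g <- T | (g * h)%g \in E] is Some g then y (g * h)%g else z h.

Lemma implant_in E T y z g h :
  disjoint_translates E T -> g \in T -> (g * h)%g \in E ->
  implant E T y z h = y (g * h)%g.
Proof.
move=> Tsep gT ghE; rewrite /implant.
have : g \in [seq g <- T | (g * h)%g \in E] by rewrite mem_filter ghE.
case E0 : [seq g <- T | _] => [//|g' s] _ /=.
have : g' \in [seq g <- T | (g * h)%g \in E] by rewrite E0 mem_head.
by rewrite mem_filter => /andP[g'hE g'T]; rewrite (Tsep g g' h).
Qed.

Lemma implant_out E T y z h : (forall g, g \in T -> (g * h)%g \notin E) ->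
  implant E T y z h = z h.
Proof.
move=> out; rewrite /implant.
case E0 : [seq g <- T | _] => [//|g s] /=.
have : g \in [seq g <- T | (g * h)%g \in E] by rewrite E0 mem_head.
by rewrite mem_filter => /andP[ghE /out]; rewrite ghE.
Qed.

(** Outside the translates of [K] the implants do not change [z], and a window of
    shape [M] that meets a translate of [K] lies in the same translate of [E],
    where the new configuration is a translate of [y]: so every window of the new
    configuration occurs in [X]. *)
Lemma implant_mem E K M T x y z :
  (forall g u, X u -> X (shift_act g u)) ->
  (forall u, (forall g, exists2 w, X w & agree_on M w (shift_act g u)) -> X u) ->
  (forall k m m', k \in K -> m \in M -> m' \in M -> (k * (m^-1 * m'))%g \in E) ->
  (forall h, h \notin K -> x h = y h) ->
  X y -> X z -> disjoint_translates E T ->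
  (forall g, g \in T -> agree_on E x (shift_act g z)) ->
  X (implant E T y z).
Proof.
move=> Xinv window KME xy Xy Xz Tsep Tz.
have implantz h : (forall g, g \in T -> (g * h)%g \notin K) ->
    implant E T y z h = z h.
  move=> outK.
  have [[g gT ghE]|noE] := pselect (exists2 g, g \in T & (g * h)%g \in E).
    rewrite (implant_in _ _ Tsep gT ghE) -xy; last exact: outK.
    by rewrite (Tz g gT _ ghE) /shift_act mulKg.
  by apply: implant_out => g gT; apply/negP => ghE; apply: noE; exists g.
apply: window => c.
have [[g [m [gT mM gmK]]]|noK] := pselect (exists g m,
    [/\ g \in T, m \in M & (g * (c^-1 * m))%g \in K]).
  exists (shift_act (c * g^-1)%g y); first exact: Xinv.
  move=> m' m'M; rewrite /shift_act (implant_in _ _ Tsep gT).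
    by rewrite invgM invgK mulgA.
  have := KME _ _ _ gmK mM m'M.
  by rewrite !mulgA mulgK.
exists (shift_act c z); first exact: Xinv.
move=> m mM; rewrite /shift_act implantz // => g gT; apply/negP => gmK.
by apply: noK; exists g, m.
Qed.

End FiniteType.

(** * Positive entropy *)

Lemma open_far (R : realType) (Y : metricType R) (p : Y) (r : R) :
  open [set v | r < mdist p v].
Proof.
rewrite openE => v /= pv; apply/nbhs_ballP.
exists (mdist p v - r); first by rewrite /= subr_gt0.
move=> w; rewrite ballEmdist /= => vw.
by have := metric_triangle p w v; rewrite (metric_sym w); lra.
Qed.

Lemma open_cover_far (R : realType) (Y : metricType R) (p q : Y) (r : R) :
  r + r < mdist p q ->
  open_cover [set [set v | r < mdist p v]; [set v | r < mdist q v]].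
Proof.
move=> rpq; split=> [_ [] ->|]; try exact: open_far.
apply/seteqP; split => // v _; have [pv|pv] := ltP r (mdist p v).
  by exists [set v | r < mdist p v]; [left | ].
exists [set v | r < mdist q v]; first by right.
by have := metric_triangle p v q; rewrite /= (metric_sym v); lra.
Qed.

Section Independence.
Variables (G : groupType) (Y : topologicalType) (S : G -> Y -> Y).
Variables (U0 U1 : set Y).
Hypothesis S_action : is_continuous_action S.
Hypothesis Y_compact : compact [set: Y].
Hypothesis U_cover : open_cover [set U0; U1].

(** A member of the joint cover assigns to every [g] of [T] one of [U0] and
    [U1], hence contains at most one of the points [w s]. *)
Lemma cover_number_independent (F T : {fset G}) (w : {ffun T -> bool} -> Y) :
  (T `<=` F)%fset ->
  (forall (s : {ffun T -> bool}) (g : T),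
    ~ (if s g then U1 else U0) (S (val g) (w s))) ->
  (2 ^ #|` T| <= cover_number S [set U0; U1] F)%N.
Proof.
move=> TF wU; rewrite -card_bool cardfE -card_ffun.
apply: (card_le_min_subcover (p := w)); first exact: finite_join_cover.
move=> _ s t [W WU <-] /(mem_join_cover S_action) sW /(mem_join_cover S_action) tW.
apply/ffunP => g; have gF : val g \in F by apply: (fsubsetP TF); exact: valP.
have := wU s g; have := wU t g; have := sW _ gF; have := tW _ gF.
by case: (WU _ gF) => ->; case: (s g); case: (t g).
Qed.

End Independence.

Section AsymptoticPair.
Variables (R : realType) (G : groupType) (A : alphabetType).
Variable X : set (fullshift G A).
Hypothesis X_subshift : is_subshift X.
Hypothesis X_SFT : is_SFT X.
Hypothesis X_measure : has_full_invariant_measure R X.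
Variables (Y : metricType R) (S : G -> Y -> Y) (phi : fullshift G A -> Y).
Hypothesis Y_compact : compact [set: Y].
Hypothesis S_action : is_continuous_action S.
Hypothesis phi_continuous : {within X, continuous phi}.
Hypothesis phi_equivariant :
  forall g u, X u -> phi (shift_act g u) = S g (phi u).

(** [E] is large enough for a point of [X] that agrees with [x] (or [y]) on [E]
    to be sent close to [phi x] (or [phi y]), and for the pattern of [y] to be
    implanted in place of that of [x]. *)
Lemma asymptotic_pair_cover_growth x y :
  X x -> X y -> asymptotic x y -> phi x <> phi y ->
  exists U, open_cover U /\ exists2 c : R, 0 < c &
    forall F, c * #|` F|%:R <= ln (cover_number S U F)%:R.
Proof.
move=> Xx Xy [K xyK] phixy; have [Xcl Xinv] := X_subshift.
pose r := mdist (phi x) (phi y) / 3.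
have d0 : 0 < mdist (phi x) (phi y) by rewrite mdist_gt0; exact/eqP.
have r0 : 0 < r by rewrite divr_gt0.
have [D D_unif] := uniform_continuity Xcl phi_continuous r0.
have [M M_window] := SFT_window X_SFT.
pose Q := [fset (m^-1 * m')%g | m in M, m' in M]%fset.
pose E := (1%g |` (D `|` [fset (k * d)%g | k in K, d in Q]))%fset.
have DE h : h \in D -> h \in E by rewrite !inE => ->; rewrite orbT.
have KME k m m' : k \in K -> m \in M -> m' \in M -> (k * (m^-1 * m'))%g \in E.
  move=> kK mM m'M; rewrite !inE; apply/orP; right; apply/orP; right.
  apply/imfset2P; exists k => //; exists (m^-1 * m')%g => //.
  by apply/imfset2P; exists m => //; exists m'.
have E0 : E != fset0 by apply/fset0Pn; exists 1%g; rewrite !inE eqxx.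
have [q q0 sepE] := exists_disjoint_translates E0.
have [alpha alpha0 occ] := frequent_occurrences E Xcl X_measure Xx.
pose U0 := [set u | r < mdist (phi x) u].
pose U1 := [set u | r < mdist (phi y) u].
have U_cover : open_cover [set U0; U1].
  by apply: open_cover_far; rewrite /r; lra.
have close u z : X u -> X z -> agree_on E u z -> ~ r < mdist (phi u) (phi z).
  move=> Xu Xz uz; apply/negP; rewrite -leNgt ltW //; apply: D_unif => // h hD.
  exact: uz (DE _ hD).
have ln2 : 0 < ln 2 :> R by rewrite ln_gt0 // ltr1n.
have qR : 0 < q%:R :> R by rewrite ltr0n.
exists [set U0; U1]; split => //.
exists (alpha / q%:R * ln 2) => [|F]; first by rewrite !mulr_gt0 // invr_gt0.
have [z Xz Fz] := occ F.
have [T [TF Tsep Tcard]] :=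
  sepE [fset g in F | `[< agree_on E x (shift_act g z) >]]%fset.
have Tz g : g \in T -> agree_on E x (shift_act g z).
  by move=> /(fsubsetP TF); rewrite !inE => /andP[_ /asboolP].
have TsubF : (T `<=` F)%fset.
  by apply: fsubset_trans TF _; apply/fsubsetP => g; rewrite !inE => /andP[].
(* The set of the places where [s] selects the pattern of [y]. *)
pose sub (s : {ffun T -> bool}) : {fset G} :=
  [fset g in T | if insub g is Some g' then s g' else false]%fset.
have mem_sub s (g : T) : (val g \in sub s) = s g.
  by rewrite !inE valK /= (valP g).
have subT s g : g \in sub s -> g \in T by rewrite !inE => /andP[].
have sub_sep s : disjoint_translates E (sub s).
  by move=> g g' h /subT gT /subT g'T; exact: Tsep.
have Xw s : X (implant E (sub s) y z).
  by apply: (implant_mem Xinv M_window KME xyK) => // g /subT; exact: Tz.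
have TN : (2 ^ #|` T| <= cover_number S [set U0; U1] F)%N.
  apply: (cover_number_independent S_action Y_compact U_cover
    (w := fun s => phi (implant E (sub s) y z))) TsubF _.
  move=> s g; rewrite -phi_equivariant //.
  have Xgw := Xinv (val g) _ (Xw s).
  case: ifP => sg; apply: close => // h hE.
    rewrite /shift_act (implant_in _ _ (sub_sep s) (_ : val g \in sub s)).
    - by rewrite mulVKg.
    - by rewrite mem_sub.
    - by rewrite mulVKg.
  rewrite (Tz _ (valP g) h hE) /shift_act implant_out // => g' g's.
  apply/negP => g'hE; have gg' : val g = g'.
    apply: (Tsep _ _ ((val g)^-1 * h)%g) (valP g) (subT _ _ g's) _ g'hE.
    by rewrite mulVKg.
  by move: g's; rewrite -gg' mem_sub sg.
apply: le_trans (_ : #|` T|%:R * ln 2 <= _); last first.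
  rewrite mulr_natl -lnXn // -natrX.
  by rewrite ler_ln ?ler_nat ?posrE ?ltr0n ?expn_gt0 // (leq_trans _ TN) ?expn_gt0.
rewrite mulrAC ler_wpM2r ?(ltW ln2) // mulrAC ler_pdivrMr // -natrM.
by apply: le_trans Fz _; rewrite ler_nat.
Qed.

Lemma asymptotic_pair_positive_entropy x y (F : nat -> {fset G}) :
  X x -> X y -> asymptotic x y -> phi x <> phi y -> is_folner R F ->
  (0 < topological_entropy R F S)%E.
Proof.
move=> Xx Xy xy phixy F_folner.
have [U [U_cover [c c0 growth]]] := asymptotic_pair_cover_growth Xx Xy xy phixy.
apply: lt_le_trans (_ : c%:E <= _)%E; first by rewrite lte_fin.
apply: le_trans (ereal_sup_ubound _); last by exists U.
rewrite lee_fin; apply: limr_ge.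
  exact: (cover_entropy_cvg S_action Y_compact U_cover F_folner
    (inhabits (phi x))).
apply: nearW => n; rewrite [leRHS]mulrC ler_pdivlMr; first exact: growth.
by rewrite ltr0n cardfs_gt0; case: F_folner.
Qed.

End AsymptoticPair.

Theorem corollary5p9 (R : realType) (G : groupType)
    (G_countable : countable [set: G]) (G_amenable : amenable R G)
    (A : alphabetType) (X : set (fullshift G A))
    (X_subshift : is_subshift X) (X_SFT : is_SFT X)
    (X_measure : has_full_invariant_measure R X)
    (X_BCE : BCE X) :
  topological_CPE R X (@shift_act G A).
Proof.
move=> Y S Y_compact S_action [phi [phi_cont phiX phiS]] [v [v' vv']] F.
have [Xcl _] := X_subshift.
have [a Xa va] : (phi @` X) v by rewrite phiX.
have [b Xb vb] : (phi @` X) v' by rewrite phiX.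
have [|x [y [Xx Xy xy phixy]]] :=
    BCE_separates_asymptotic_pair Xcl phi_cont X_BCE Xa Xb.
  by rewrite va vb.
exact: (asymptotic_pair_positive_entropy X_subshift X_SFT X_measure Y_compact
  S_action phi_cont phiS Xx Xy xy phixy).
Qed.
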